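(* Let $V$ be a vertex operator algebra whose Zhu's algebra $A(V)$ is semisimple, and let $M$ be an admissible $V$-module. For every $\lambda\in\mathbb{C}$, the subspace $\bigoplus_{n\in\mathbb{Z}}M^{(\lambda+n)}$ is an admissible $V$-submodule of $M$. Therefore, $N=\bigoplus_{\lambda\in\mathbb{C}}M^{(\lambda)}$ is also an admissible $V$-submodule of $M$.
   Context: $\mathbb{N}$ is the set of nonnegative integers. Let $V=(V,Y,\mathbf 1,\omega)$ be a vertex operator algebra over $\mathbb{C}$, $Y(a,z)=\sum_{n\in\mathbb{Z}}a(n)z^{-n-1}$, graded by eigenvalues of $L(0)=\omega(1)$; $\mathrm{wt}(a)$ denotes the $L(0)$-eigenvalue of a homogeneous $a$. A weak $V$-module is a vector space $M$ with a linear map $Y_M:V\to(\mathrm{End}\,M)[[z,z^{-1}]]$, $Y_M(a,z)=\sum_{n\in\mathbb{Z}}a(n)z^{-n-1}$, such that $Y_M(a,z)u\in M((z))$ for $a\in V$, $u\in M$, $Y_M(\mathbf 1,z)=\mathrm{id}_M$, and the Jacobi identity $z_0^{-1}\delta(\frac{z_1-z_2}{z_0})Y_M(a,z_1)Y_M(b,z_2)-z_0^{-1}\delta(\frac{z_2-z_1}{-z_0})Y_M(b,z_2)Y_M(a,z_1)=z_2^{-1}\delta(\frac{z_1-z_0}{z_2})Y_M(Y(a,z_0)b,z_2)$ holds. Write $Y_M(\omega,z)=\sum_nL(n)z^{-n-2}$. An admissible $V$-module is a weak $V$-module with an $\mathbb{N}$-grading $M=\bigoplus_{n=0}^\infty M_n$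 such that $a(n)M_m\subset M_{\mathrm{wt}(a)+m-n-1}$ for homogeneous $a$ ($M_m=0$ for $m<0$). Its degree operator $d$ acts on $M_n$ by $n$. An admissible submodule is a subspace stable under all $a(n)$ and under $d$. Zhu's algebra: for homogeneous $a\in V$ and $b\in V$ put $a\circ b=\mathrm{Res}_z\frac{(1+z)^{\mathrm{wt}(a)}}{z^2}Y(a,z)b$ and $a*b=\mathrm{Res}_z\frac{(1+z)^{\mathrm{wt}(a)}}{z}Y(a,z)b$ (extended linearly in $a$); $O(V)$ is the span of all $a\circ b$ and $A(V)=V/O(V)$, an associative algebra under $*$. For a weak $V$-module $M$ and $\lambda\in\mathbb{C}$, $M^{(\lambda)}=\{u\in M\mid (L(0)-\lambda)^ku=0\text{ for some }k\in\mathbb{N}\}$. *)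

(* Defs.v *)
From HB Require Import structures.
From mathcomp Require Import all_boot all_order all_algebra.
From mathcomp Require Import generic_quotient ring_quotient.
From mathcomp Require Import boolp classical_sets functions cardinality fsbigop.
From mathcomp Require Import reals complex.

Set Implicit Arguments.
Unset Strict Implicit.
Unset Printing Implicit Defensive.

Import Order.TTheory GRing.Theory Num.Theory.

Local Open Scope classical_set_scope.
Local Open Scope ring_scope.

(** * Sums of families of subspaces and homogeneous components *)

Section Families.
Variables (E : zmodType) (I : choiceType).
Implicit Types (U : I -> set E) (f : I -> E) (u : E).

Definition decomposes U u f :=
  [/\ finite_set [set i | f i != 0], forall i, U i (f i)
    & u = \sum_(i \in [set: I]) f i].

Definition sum_family U : set E := [set u | exists f, decomposes U u f].

Definition independent U := forall f, decomposes U 0 f -> forall i, f i = 0.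

Definition direct_sum U (S : set E) := independent U /\ sum_family U = S.

(* If E is the direct sum of the U i, this is the i-th component of u. *)
Definition component U u : I -> E := xget (fun=> 0) (decomposes U u).

End Families.

Section Subspaces.
Variables (K : fieldType) (E : lmodType K).

Definition subspace (U : set E) :=
  U 0 /\ forall (c : K) u v, U u -> U v -> U (c *: u + v).

Definition span (S : set E) : set E := smallest subspace S.

Definition finite_dim (U : set E) :=
  exists s : seq E, forall u, U u ->
    exists c : nat -> K, u = \sum_(i < size s) c i *: s`_i.

End Subspaces.

(** * Vertex operator algebras and modules *)

(* x (x - 1) ... (x - i + 1) / i!, the coefficient of z^i in (1 + z)^x *)
Definition gbinom (K : fieldType) (x : K) (i : nat) : K :=
  (\prod_(j < i) (x - j%:R)) / i`!%:R.

(* A field Y a n u stands for a(n)u, where Y(a,z) = sum_n a(n) z^(-n-1).      *)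
(* Below is the coefficient of z0^(-l-1) z1^(-m-1) z2^(-n-1) in the Jacobi    *)
(* identity, applied to u. Powers (z1 - z2)^l, (z2 - z1)^l and                *)
(* (z1 - z0)^(i-m-1) inside the delta functions are expanded in nonnegative   *)
(* powers of their second variable; on the right, the coefficient             *)
(* (-1)^i binom(i-m-1, i) has been rewritten as binom(m, i). All three sums   *)
(* are finitely supported when Y and YM satisfy the truncation condition.     *)
Definition jacobi_identity (K : fieldType) (V M : lmodType K)
    (Y : V -> int -> V -> V) (YM : V -> int -> M -> M) :=
  forall (a b : V) (u : M) (l m n : int),
    \sum_(i \in [set: nat]) ((-1) ^+ i * gbinom l%:~R i) *:
        YM a (m + l - i%:Z) (YM b (n + i%:Z) u)
    - \sum_(i \in [set: nat]) ((-1) ^ l * (-1) ^+ i * gbinom l%:~R i) *: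
        YM b (n + l - i%:Z) (YM a (m + i%:Z) u)
    = \sum_(i \in [set: nat]) gbinom m%:~R i *:
        YM (Y a (l + i%:Z) b) (m + n - i%:Z) u.

Definition truncated (K : fieldType) (V M : lmodType K)
    (YM : V -> int -> M -> M) :=
  forall a u, exists N : int, forall n, N <= n -> YM a n u = 0.

Definition eigenspace_of (K : fieldType) (E : lmodType K) (T : E -> E)
  (c : K) : set E := [set v | T v = c *: v].

Record voa (K : numFieldType) := VOA {
  voa_sort :> lmodType K;
  vmode : voa_sort -> int -> voa_sort -> voa_sort;
  vac : voa_sort;
  conf : voa_sort;
  central_charge : K;
  vmode_linearl : forall n v, linear (fun a => vmode a n v);
  vmode_linearr : forall a n, linear (vmode a n);
  vmode_truncated : truncated vmode;
  vmode_vac : forall n v, vmode vac n v = if n == -1 then v else 0;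
  vmode_creation : forall a, vmode a (-1) vac = a
    /\ forall n : nat, vmode a n%:Z vac = 0;
  vmode_jacobi : jacobi_identity vmode vmode;
  (* the Virasoro relations, with L(n) = conf(n+1) *)
  vmode_virasoro : forall (m n : int) v,
    vmode conf (m + 1) (vmode conf (n + 1) v)
      - vmode conf (n + 1) (vmode conf (m + 1) v)
    = (m - n)%:~R *: vmode conf (m + n + 1) v
      + (if m + n == 0 then (m ^+ 3 - m)%:~R / 12%:R * central_charge else 0)
          *: v;
  (* Y(L(-1)a,z) = d/dz Y(a,z) *)
  vmode_derivative : forall a n v,
    vmode (vmode conf 0 a) n v = (- n)%:~R *: vmode a (n - 1) v;
  voa_graded :
    direct_sum (fun w : int => eigenspace_of (vmode conf 1) w%:~R) setT;
  voa_finite_dim : forall w : int,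
    finite_dim (eigenspace_of (vmode conf 1) w%:~R);
  voa_bounded_below : exists N : int, forall w : int, w < N ->
    eigenspace_of (vmode conf 1) w%:~R = [set 0];
  vac_weight : eigenspace_of (vmode conf 1) 0 vac;
  conf_weight : eigenspace_of (vmode conf 1) 2%:R conf
}.

Definition homog (K : numFieldType) (V : voa K) (w : int) : set V :=
  eigenspace_of (vmode (conf V) 1) w%:~R.

Record weak_module (K : numFieldType) (V : voa K) := WeakModule {
  wm_sort :> lmodType K;
  mmode : V -> int -> wm_sort -> wm_sort;
  mmode_linearl : forall n u, linear (fun a => mmode a n u);
  mmode_linearr : forall a n, linear (mmode a n);
  mmode_truncated : truncated mmode;
  mmode_vac : forall n u, mmode (vac V) n u = if n == -1 then u else 0;
  mmode_jacobi : jacobi_identity (@vmode K V) mmode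
}.

Definition L0 (K : numFieldType) (V : voa K) (M : weak_module V) : M -> M :=
  mmode (conf V) 1.

Definition gen_eigenspace (K : numFieldType) (V : voa K) (M : weak_module V)
    (lambda : K) : set M :=
  [set u | exists k : nat, iter k (fun v => L0 v - lambda *: v) u = 0].

Definition int_graded (K : fieldType) (E : lmodType K) (g : nat -> set E)
    (k : int) : set E :=
  match k with Posz n => g n | Negz _ => [set 0] end.

Record adm_module (K : numFieldType) (V : voa K) := AdmModule {
  adm_weak :> weak_module V;
  adm_grade : nat -> set adm_weak;
  adm_grade_subspace : forall n, subspace (adm_grade n);
  adm_graded : direct_sum adm_grade setT;
  adm_mode_grade : forall (w : int) (a : V), homog w a ->
    forall (n : int) (m : nat) u, adm_grade m u ->
      int_graded adm_grade (w + m%:Z - n - 1) (mmode a n u)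
}.

Definition degree_op (K : numFieldType) (V : voa K) (M : adm_module V)
    (u : M) : M :=
  \sum_(n \in [set: nat]) n%:R *: component (@adm_grade K V M) u n.

Definition adm_submodule (K : numFieldType) (V : voa K) (M : adm_module V)
    (S : set M) :=
  [/\ subspace S,
      forall (a : V) (n : int) u, S u -> S (mmode a n u)
    & forall u, S u -> S (degree_op u)].

(** * Zhu's algebra *)

Section Zhu.
Variables (K : numFieldType) (V : voa K).

(* Res_z (1+z)^wt(a) z^(-k) Y(a,z)b, extended linearly in a; the coefficient  *)
(* of z^(-1) in z^(i-k) Y(a_w,z)b is a_w(i-k)b, for a_w of weight w.          *)
Definition zhu_residue (k : nat) (a b : V) : V :=
  \sum_(w \in [set: int]) \sum_(i \in [set: nat])
    gbinom w%:~R i *: vmode (component (@homog K V) a w) (i%:Z - k%:Z) b.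

Definition zhu_circ : V -> V -> V := zhu_residue 2.
Definition zhu_star : V -> V -> V := zhu_residue 1.

Definition zhu_O : {pred V} :=
  fun x => `[< span [set zhu_circ p.1 p.2 | p in [set: V * V]] x >].

Lemma zhu_O_zmod_closed : zmod_closed zhu_O.
Proof.
split=> [|x y /asboolP Ox /asboolP Oy]; apply/asboolP => U [[U0 UL] subU].
  exact: U0.
have Ux := Ox _ (conj (conj U0 UL) subU).
have Uy := Oy _ (conj (conj U0 UL) subU).
by rewrite addrC -scaleN1r; exact: UL.
Qed.

HB.instance Definition _ := GRing.isZmodClosed.Build V zhu_O zhu_O_zmod_closed.

Definition zhu_algebra : zmodType := Quotient.quot zhu_O.

(* The class of the product of representatives; the choice of these does not  *)
(* matter, zhu_O being a two-sided ideal for zhu_star (Zhu's theorem).        *)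
Definition zhu_mul : zhu_algebra -> zhu_algebra -> zhu_algebra :=
  lift_op2 (Quotient.quot zhu_O) zhu_star.

End Zhu.

(** * Semisimplicity of a ring given by its multiplication *)

(* Left ideals are those of the ring (A, +, mul). In a unital algebra they    *)
(* are automatically closed under scalars, so no scaling is needed.           *)
Section Semisimple.
Variables (A : zmodType) (mul : A -> A -> A).

Definition left_ideal (J : set A) :=
  [/\ J 0, forall x y, J x -> J y -> J (x - y)
    & forall x y, J y -> J (mul x y)].

Definition simple_left_ideal (J : set A) :=
  [/\ left_ideal J, J <> [set 0]
    & forall J', left_ideal J' -> J' `<=` J -> J' = [set 0] \/ J' = J].

(* The left regular module is a finite direct sum of simple submodules; as    *)
(* the ring is unital, finiteness of the sum is no restriction.               *)
Definition semisimple :=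
  exists (n : nat) (J : 'I_n -> set A),
    (forall i, simple_left_ideal (J i)) /\ direct_sum J setT.

End Semisimple.

Definition zhu_semisimple (K : numFieldType) (V : voa K) :=
  semisimple (@zhu_mul K V).

(* Main.v *)
Require Import Defs.
From HB Require Import structures.
From mathcomp Require Import all_boot all_order all_algebra finmap.
From mathcomp Require Import boolp classical_sets functions cardinality fsbigop.
From mathcomp Require Import reals complex.
From mathcomp Require Import ring zify.

(** For [a] of weight [w], the Jacobi identity gives the commutation relation
    [[L(0), a(n)] = (w - n - 1) a(n)] on every weak module, so [a(n)] maps the
    generalized eigenspace of [mu] into that of [mu + w - n - 1]
    ([mode_gen_eigenspace]). The shift is an integer, hence a sum of
    generalized eigenspaces over a set of eigenvalues stable under integer
    translations is stable under the modes of homogeneous vectors, and then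
    under all modes because the homogeneous vectors span [V].

    For the degree operator, [omega] has weight 2, so [L(0) = omega(1)]
    preserves each graded piece of the module. It therefore commutes with [d],
    and [d] preserves each generalized eigenspace ([degree_op_L0]).

    Generalized eigenspaces of any linear operator for distinct eigenvalues are
    independent ([root_space_independent]), so the sums are direct.

    Both families of the theorem, the coset [lambda + Z] and all of the ground
    field, are instances of [root_sum_adm_submodule], where the eigenvalues are
    the values of an injective function whose image is stable under integer
    translations. *)

Set Implicit Arguments.
Unset Strict Implicit.
Unset Printing Implicit Defensive.

Import GRing.Theory Num.Theory.

Local Open Scope classical_set_scope.
Local Open Scope ring_scope.

(** * Sums of families of subspaces *)

Lemma fsum_seq (E : zmodType) (I : choiceType) (s : seq I) (f : I -> E) :
  uniq s -> (forall i, i \notin s -> f i = 0) ->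
  \sum_(i \in [set: I]) f i = \sum_(i <- s) f i.
Proof.
move=> us f0; rewrite (fsbigE s) => //; last by move=> i _; exact: f0.
by apply: eq_bigl => i; rewrite in_setT.
Qed.

Section Decompositions.
Variables (K : fieldType) (E : lmodType K) (I : choiceType).
Implicit Types (U : I -> set E) (f g : I -> E) (u v : E).

Lemma decomposesP U u f :
  decomposes U u f <->
  exists X : {fset I}, [/\ forall i, i \notin X -> f i = 0,
    forall i, U i (f i) & u = \sum_(i <- X) f i].
Proof.
split=> [[finf Uf ->]|[X [f0 Uf ->]]].
  exists (fset_set [set i | f i != 0]).
  have f0 i : i \notin fset_set [set i | f i != 0] -> f i = 0.
    by rewrite in_fset_set// notin_setE /= => /negP; rewrite negbK => /eqP.
  by split=> //; apply: fsum_seq => //; exact: fset_uniq.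
split=> //; last by rewrite (fsum_seq (fset_uniq X)).
apply: sub_finite_set (finite_fset X) => i /=.
by apply: contra_neqT; exact: f0.
Qed.

Lemma decomposes_lincomb U (c : K) u v f g : (forall i, subspace (U i)) ->
  decomposes U u f -> decomposes U v g ->
  decomposes U (c *: u + v) (fun i => c *: f i + g i).
Proof.
move=> subU /decomposesP[X [f0 Uf ->]] /decomposesP[Y [g0 Ug ->]].
apply/decomposesP; exists (X `|` Y)%fset; split.
- move=> i; rewrite inE negb_or => /andP[iX iY].
  by rewrite f0// g0// scaler0 addr0.
- by move=> i; case: (subU i) => _; apply.
rewrite big_split -scaler_sumr /=; congr (_ *: _ + _).
  rewrite -(fsum_seq (fset_uniq _) f0) -(fsum_seq (fset_uniq _))// => i.
  by rewrite inE negb_or => /andP[iX _]; exact: f0.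
rewrite -(fsum_seq (fset_uniq _) g0) -(fsum_seq (fset_uniq _))// => i.
by rewrite inE negb_or => /andP[_ iY]; exact: g0.
Qed.

Lemma decomposes_linear U (A : {linear E -> E}) u f :
  (forall i x, U i x -> U i (A x)) ->
  decomposes U u f -> decomposes U (A u) (A \o f).
Proof.
move=> UA /decomposesP[X [f0 Uf ->]]; apply/decomposesP; exists X; split.
- by move=> i /f0 fi0 /=; rewrite fi0 raddf0.
- by move=> i; exact: UA.
exact: raddf_sum.
Qed.

Lemma decomposes_unique U u f g : (forall i, subspace (U i)) ->
  independent U -> decomposes U u f -> decomposes U u g -> f = g.
Proof.
move=> subU indU df dg; apply/funext => i.
have := decomposes_lincomb (-1) subU df dg.
rewrite scaleN1r addNr => /indU/(_ i)/eqP.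
by rewrite scaleN1r addrC subr_eq0 => /eqP.
Qed.

Lemma sum_family_subspace U :
  (forall i, subspace (U i)) -> subspace (sum_family U).
Proof.
move=> subU; split=> [|c u v [f df] [g dg]].
  exists (fun=> 0); apply/decomposesP; exists fset0; split=> // [i|].
    by case: (subU i).
  by rewrite big_seq_fset0.
by exists (fun i => c *: f i + g i); exact: decomposes_lincomb.
Qed.

Lemma subspace_sum (S : set E) (s : seq I) f :
  subspace S -> (forall i, S (f i)) -> S (\sum_(i <- s) f i).
Proof.
move=> [S0 SD] Sf; elim: s => [|i s IHs]; first by rewrite big_nil.
by rewrite big_cons -[f i]scale1r; exact: SD.
Qed.

Lemma sum_family_min U (S : set E) :
  subspace S -> (forall i, U i `<=` S) -> sum_family U `<=` S.
Proof.
move=> subS US u [f /decomposesP[X [_ Uf ->]]].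
by apply: subspace_sum => // i; exact/US/Uf.
Qed.

Lemma sub_sum_family U i :
  (forall i, subspace (U i)) -> U i `<=` sum_family U.
Proof.
move=> subU u Uu; exists (fun j => if j == i then u else 0).
apply/decomposesP; exists [fset i]%fset; split.
- by move=> j; rewrite inE => /negbTE ->.
- by move=> j; case: eqP => [->//|_]; case: (subU j).
by rewrite big_seq_fset1 eqxx.
Qed.

End Decompositions.

Lemma linear_map0 (K : fieldType) (E F : lmodType K) (A : E -> F) :
  linear A -> A 0 = 0.
Proof.
by move=> linA; have := linA (-1) 0 0; rewrite scaler0 addr0 scaleN1r addNr.
Qed.

Lemma subspace_preim (K : fieldType) (E F : lmodType K) (A : E -> F)
    (S : set F) :
  linear A -> subspace S -> subspace (A @^-1` S).
Proof.
move=> linA [S0 SD]; split=> [|c u v Su Sv] /=; last by rewrite linA; exact: SD.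
by rewrite /= (linear_map0 linA).
Qed.

(** * Generalized eigenspaces of a linear operator *)

Section RootSpaces.
Variables (K : fieldType) (E : lmodType K) (T : {linear E -> E}).
Implicit Types (c mu : K) (u v : E) (A : E -> E).

Definition shift c v := T v - c *: v.

Definition root_space c : set E := [set u | exists k, iter k (shift c) u = 0].

Fact shift_linear c : linear (shift c).
Proof.
move=> a u v; rewrite /shift linearP scalerDr scalerBr opprD !scalerA.
by rewrite [c * a]mulrC addrACA.
Qed.

HB.instance Definition _ c :=
  GRing.isLinear.Build K E E _ (shift c) (shift_linear c).

Lemma iter_shift_linear c k : linear (iter k (shift c)).
Proof. by elim: k => [//|k IHk] a u v; rewrite iterS IHk linearP. Qed.

HB.instance Definition _ c k :=
  GRing.isLinear.Build K E E _ (iter k (shift c)) (iter_shift_linear c k).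

(** The hypothesis reads [[T, A] = c A], that is,
    [(T - (mu + c)) A = A (T - mu)]. It is used for modes, where [c] is an
    integer, and with [c = 0] for operators commuting with [T]. *)
Lemma iter_shift_comm A c mu k u :
  (forall v, T (A v) = A (T v) + c *: A v) -> linear A ->
  iter k (shift (mu + c)) (A u) = A (iter k (shift mu) u).
Proof.
move=> TA linA; elim: k => [//|k IHk]; rewrite !iterS IHk /shift TA.
set x := iter _ _ _.
have -> : T x - mu *: x = (- mu) *: x + T x by rewrite scaleNr addrC.
rewrite linA scaleNr scalerDl opprD [RHS]addrC -addrA; congr (_ + _).
by rewrite addrCA subrr addr0.
Qed.

Lemma root_space_shift A c mu u :
  (forall v, T (A v) = A (T v) + c *: A v) -> linear A ->
  root_space mu u -> root_space (mu + c) (A u).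
Proof.
move=> TA linA [k uk]; exists k.
by rewrite iter_shift_comm// uk linear_map0.
Qed.

Lemma iter_shift_eq0 c k m u : (k <= m)%N ->
  iter k (shift c) u = 0 -> iter m (shift c) u = 0.
Proof. by move=> /subnK <- uk; rewrite iterD uk raddf0. Qed.

Lemma root_space_subspace c : subspace (root_space c).
Proof.
split=> [|a u v [k uk] [m vm]]; first by exists 0%N.
exists (maxn k m); rewrite linearP /=.
by rewrite (iter_shift_eq0 (leq_maxl _ _) uk) (iter_shift_eq0 (leq_maxr _ _) vm)
           scaler0 addr0.
Qed.

Lemma root_space_iter_shift a c k u :
  root_space c u -> root_space c (iter k (shift a) u).
Proof.
elim: k => [//|k IHk] /IHk ru; rewrite iterS -[c]addr0.
apply: root_space_shift ru => [v|]; last exact: shift_linear.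
by rewrite scale0r addr0 /shift linearB linearZ.
Qed.

(** Induction on the exponent for [a]: since [T - a] preserves both spaces,
    the induction hypothesis reduces to the case of a true eigenvector. *)
Lemma root_space_disjoint a c u :
  a != c -> root_space a u -> root_space c u -> u = 0.
Proof.
move=> ac [k]; elim: k u => [//|k IHk] u; rewrite iterSr => uk cu.
have /eqP : shift a u = 0.
  by apply: IHk => //; exact: (root_space_iter_shift a 1).
rewrite subr_eq0 => /eqP Tu; case: cu => m.
(* [u] is an eigenvector of [T] for [a], so [T - c] acts on it as [a - c]. *)
have -> : iter m (shift c) u = (a - c) ^+ m *: u.
  elim: m => [|m IHm]; first by rewrite scale1r.
  rewrite iterS IHm linearZ /=.
  by rewrite /shift Tu -scalerBl scalerA exprSr.
by move/eqP; rewrite scaler_eq0 expf_eq0 subr_eq0 (negbTE ac) andbF => /eqP.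
Qed.

(** Induction on the number of terms of a vanishing sum: a power of
    [T - g j] killing the first term leaves a shorter vanishing sum, whose
    terms vanish by induction. So every other term of the original sum lies in
    two distinct generalized eigenspaces, hence is 0, and then so is the
    first. *)
Lemma root_space_independent (I : choiceType) (g : I -> K) :
  injective g -> independent (fun i => root_space (g i)).
Proof.
move=> injg f /decomposesP[X [f0 Uf sumf]] i.
have [iX|/f0//] := boolP (i \in X).
move: iX sumf; have := fset_uniq X; rewrite -[i \in X]/(i \in enum_fset X).
move: Uf; elim: (enum_fset X) f {f0} i => [//|j s IHs] f i Uf /= /andP[js us].
rewrite big_cons => ijs sumf; have [k fk] := Uf j.
have sf l : l \in s -> f l = 0.
  move=> ls; apply: (@root_space_disjoint (g j) (g l)) (Uf l).
    by apply: contraNneq js => /injg ->.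
  exists k.
  apply: (IHs (fun l => iter k (shift (g j)) (f l))) ls _ => // [m|].
    exact: root_space_iter_shift.
  have sumN : \sum_(l <- s) f l = - f j.
    by apply/eqP; rewrite -addr_eq0 addrC -sumf.
  by rewrite -raddf_sum sumN raddfN /= fk oppr0.
move: ijs; rewrite inE => /orP[/eqP ->|/sf//].
by rewrite [RHS]sumf big_seq big1 ?addr0// => l; exact: sf.
Qed.

End RootSpaces.

(** * Commutation of L(0) with the modes of a weak module *)

Lemma gbinom0n (K : numFieldType) i : gbinom (0 : K) i = (i == 0%N)%:R.
Proof.
rewrite /gbinom; case: i => [|i]; first by rewrite big_ord0 divr1.
by rewrite big_ord_recl subrr !mul0r.
Qed.

Lemma gbinom1n (K : numFieldType) i : gbinom (1 : K) i = (i < 2)%N%:R.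
Proof.
rewrite /gbinom; case: i => [|[|i]]; first by rewrite big_ord0 divr1.
  by rewrite big_ord1 subr0 divr1.
by rewrite big_ord_recl big_ord_recl subrr mul0r mulr0 mul0r.
Qed.

(** This is the expansion of [(1 - z)^-2]. *)
Lemma gbinomN2 (K : numFieldType) i :
  (-1) ^+ i * gbinom (-2 : K) i = i.+1%:R.
Proof.
rewrite /gbinom mulrA; apply: (@mulIf _ i`!%:R).
  by rewrite pnatr_eq0 -lt0n fact_gt0.
rewrite divfK ?pnatr_eq0 -?lt0n ?fact_gt0// -natrM -factS.
elim: i => [|i IHi]; first by rewrite big_ord0 mulr1.
rewrite big_ord_recr /= exprS factS natrM -IHi.
by rewrite -[i.+2]addn2 natrD; ring.
Qed.

Section WeakModules.
Variables (K : numFieldType) (V : voa K) (M : weak_module V).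
Implicit Types (a b : V) (u : M) (m n w : int).

HB.instance Definition _ a n :=
  GRing.isLinear.Build K M M _ (@mmode K V M a n) (@mmode_linearr K V M a n).

HB.instance Definition _ :=
  GRing.isLinear.Build K M M _ (@L0 K V M) (@mmode_linearr K V M (conf V) 1).

Lemma mmodeZ c a n u : mmode (c *: a) n u = c *: mmode a n u.
Proof.
have lin := mmode_linearl (w := M) n u.
have /= := lin c a 0; rewrite (linear_map0 lin) [c *: a + 0]addr0 => ->.
exact: addr0.
Qed.

Lemma mmode_vac_eq0 n u : n != -1 -> mmode (vac V) n u = 0.
Proof. by rewrite mmode_vac => /negbTE ->. Qed.

Lemma mmode_vacN1 u : mmode (vac V) (-1) u = u.
Proof. by rewrite mmode_vac eqxx. Qed.

Lemma conf0_creation b : vmode (conf V) 0 b = vmode b (-2) (vac V).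
Proof.
have [<- _] := vmode_creation (vmode (conf V) 0 b).
by rewrite vmode_derivative opprK scale1r.
Qed.

(** On [V] itself this is an axiom; on a module it follows from the Jacobi
    identity for [b] and the vacuum with [(l, m) = (-2, 0)]: there the right
    side is [(b(-2)1)(n)], and of the two sums on the left at most one
    has a term where the vacuum acts by its mode [-1], according to the sign
    of [n]. *)
Lemma mmode_derivative b n u :
  mmode (vmode (conf V) 0 b) n u = (- n)%:~R *: mmode b (n - 1) u.
Proof.
rewrite conf0_creation.
have := mmode_jacobi (w := M) b (vac V) u (-2) 0 n.
rewrite [X in _ = X -> _](@fsum_seq _ _ [:: 0%N])//; last first.
  by move=> i; rewrite inE gbinom0n => /negbTE ->; rewrite scale0r.
rewrite big_seq1 gbinom0n scale1r [-2 + _]addr0 [0 + n - _]subr0.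
rewrite [0 + n]add0r => <-.
have sg i : (-1) ^+ i * gbinom (-2)%:~R i = i.+1%:R :> K.
  by rewrite -gbinomN2 mulrNz.
have -> : \sum_(i \in [set: nat]) ((-1) ^+ i * gbinom (-2)%:~R i) *:
    mmode b (0 + -2 - i%:Z) (mmode (vac V) (n + i%:Z) u) =
    if n is Negz k then k.+1%:R *: mmode b (n - 1) u else 0.
  case: n => [k|k].
    rewrite (@fsum_seq _ _ [::]) ?big_nil// => i _.
    by rewrite mmode_vac_eq0 ?raddf0 ?scaler0//; lia.
  rewrite (@fsum_seq _ _ [:: k])//; last first.
    move=> i; rewrite inE => ik.
    by rewrite mmode_vac_eq0 ?raddf0 ?scaler0//; lia.
  rewrite big_seq1 sg (_ : Negz k + k%:Z = -1) ?mmode_vacN1; last by lia.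
  by congr (_ *: mmode b _ u); lia.
have -> : \sum_(i \in [set: nat])
    ((-1) ^ (-2) * (-1) ^+ i * gbinom (-2)%:~R i) *:
      mmode (vac V) (n + -2 - i%:Z) (mmode b (0 + i%:Z) u) =
    if n is Posz k then k%:R *: mmode b (n - 1) u else 0.
  case: n => [[|k]|k].
  - rewrite (@fsum_seq _ _ [::]) ?big_nil ?scale0r// => i _.
    by rewrite mmode_vac_eq0 ?scaler0//; lia.
  - rewrite (@fsum_seq _ _ [:: k])//; last first.
      move=> i; rewrite inE => ik.
      by rewrite mmode_vac_eq0 ?scaler0//; lia.
    rewrite big_seq1 -mulrA sg (_ : k.+1%:Z + -2 - k%:Z = -1);
      last by lia.
    rewrite mmode_vacN1.
    rewrite -[(-1) ^ (-2)]/(((-1) ^+ 2)^-1) sqrrN expr1n invr1 mul1r.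
    by congr (_ *: mmode b _ u); lia.
  - rewrite (@fsum_seq _ _ [::]) ?big_nil// => i _.
    by rewrite mmode_vac_eq0 ?scaler0//; lia.
case: n => k; first by rewrite sub0r mulrNz scaleNr.
by rewrite subr0 NegzE opprK.
Qed.

(** The Jacobi identity with [(l, m) = (0, 1)] and first vector [omega]; its
    right side is [(L(-1)b)(n+1) + (L(0)b)(n)]. *)
Lemma L0_mmode w b n u : homog w b ->
  L0 (mmode b n u) = mmode b n (L0 u) + (w - n - 1)%:~R *: mmode b n u.
Proof.
move=> wb; have := mmode_jacobi (w := M) (conf V) b u 0 1 n.
rewrite (@fsum_seq _ _ [:: 0%N])//; last first.
  by move=> i; rewrite inE gbinom0n => /negbTE ->; rewrite mulr0 scale0r.
rewrite [X in _ - X](@fsum_seq _ _ [:: 0%N])//; last first.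
  by move=> i; rewrite inE gbinom0n => /negbTE ->; rewrite mulr0 scale0r.
rewrite [X in _ = X -> _](@fsum_seq _ _ [:: 0%N; 1%N])//; last first.
  by move=> [|[|i]]//; rewrite gbinom1n scale0r.
rewrite !big_cons !big_nil !gbinom0n !gbinom1n /= !mulr1 !scale1r !addr0.
rewrite add0r [1 + n]addrC addrK mmode_derivative addrK [vmode _ _ b]wb mmodeZ.
rewrite /L0 => /eqP; rewrite subr_eq => /eqP ->.
rewrite [RHS]addrC; congr (_ + _).
rewrite -scalerDl -rmorphD /=.
by rewrite (_ : - (n + 1) + w = w - n - 1)//; lia.
Qed.

Lemma mode_gen_eigenspace w b n mu u : homog w b ->
  gen_eigenspace (M := M) mu u ->
  gen_eigenspace (M := M) (mu + (w - n - 1)%:~R) (mmode b n u).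
Proof.
move=> wb; apply: root_space_shift => [v|]; first exact: L0_mmode.
exact: mmode_linearr.
Qed.

End WeakModules.

(** * The degree operator *)

Section AdmissibleModules.
Variables (K : numFieldType) (V : voa K) (M : adm_module V).
Implicit Types (u v : M) (f : nat -> M).

Let grade_decomposition u : exists f, decomposes (@adm_grade K V M) u f.
Proof.
have [_ /predeqP/(_ u)[_]] := adm_graded M; exact.
Qed.

(** Any decomposition of [u] computes [d u]; as it exhibits the components of
    [d u] as well, linearity of [d] and its commutation with [L(0)] reduce to
    comparing components. *)
Lemma degree_op_decomposes u f : decomposes (@adm_grade K V M) u f ->
  decomposes (@adm_grade K V M) (degree_op u) (fun n => n%:R *: f n).
Proof.
move=> df; have [indM _] := adm_graded M.
have -> : degree_op u = \sum_(n \in [set: nat]) n%:R *: f n.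
  apply: eq_fsbigr => n _; congr (_ *: _).
  suff -> : component (@adm_grade K V M) u = f by [].
  apply: decomposes_unique (xgetPex _ (grade_decomposition u)) df => //.
  exact: adm_grade_subspace.
have /decomposesP[X [f0 Uf _]] := df.
have nf0 n : n \notin X -> n%:R *: f n = 0 by move/f0 ->; rewrite scaler0.
apply/decomposesP; exists X; split=> // [n|].
  have [U0 UD] := @adm_grade_subspace K V M n.
  by rewrite -[_ *: _]addr0; exact: UD.
by rewrite (fsum_seq (fset_uniq X)).
Qed.

Lemma degree_op_linear : linear (@degree_op K V M).
Proof.
move=> c u v; have [f df] := grade_decomposition u.
have [g dg] := grade_decomposition v.
have subM := @adm_grade_subspace K V M.
have [_ _ ->] := degree_op_decomposes (decomposes_lincomb c subM df dg).
have [_ _ ->] := decomposes_lincomb c subM (degree_op_decomposes df)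
  (degree_op_decomposes dg).
apply: eq_fsbigr => n _; rewrite scalerDr !scalerA.
by rewrite [c * _]mulrC.
Qed.

(** [omega] has weight 2, so its mode [omega(1)] has degree 0. *)
Lemma L0_grade n u : adm_grade n u -> adm_grade n (L0 u).
Proof.
have confw : homog 2 (conf V) by exact: conf_weight.
move=> /(adm_mode_grade confw 1).
by rewrite (_ : 2 + n%:Z - 1 - 1 = n%:Z)//; lia.
Qed.

Lemma degree_op_L0 u : L0 (degree_op u) = degree_op (L0 u).
Proof.
have [f df] := grade_decomposition u.
have dL g v := @decomposes_linear _ _ _ (@adm_grade K V M) (@L0 K V M) v g
  L0_grade.
have [_ _ ->] := dL _ _ (degree_op_decomposes df).
have [_ _ ->] := degree_op_decomposes (dL _ _ df).
by apply: eq_fsbigr => n _ /=; rewrite linearZ.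
Qed.

Lemma degree_op_gen_eigenspace mu u :
  gen_eigenspace (M := M) mu u -> gen_eigenspace (M := M) mu (degree_op u).
Proof.
move=> ru; rewrite -[mu]addr0; apply: root_space_shift ru => [v|].
  by rewrite scale0r addr0; exact: degree_op_L0.
exact: degree_op_linear.
Qed.

(** * Sums of generalized eigenspaces *)

(** Stability is checked on spanning sets, with the other argument fixed:
    homogeneous vectors for the mode [a(n)], generalized eigenvectors for [u].
    The second hypothesis on [g] keeps the shifted eigenvalue in the
    family. *)
Lemma root_sum_adm_submodule (I : choiceType) (g : I -> K) :
  injective g -> (forall i (k : int), exists j, g j = g i + k%:~R) ->
  let F := fun i => gen_eigenspace (M := M) (g i) in
  independent F /\ adm_submodule (sum_family F).
Proof.
move=> injg shg F.
have subF i : subspace (F i) by exact: (root_space_subspace (@L0 K V M)).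
have subS := sum_family_subspace subF.
split; first exact: (@root_space_independent _ _ (@L0 K V M) _ g injg).
split=> // [a n u Su|].
- have [_ /predeqP/(_ a)[_ Va]] := voa_graded V.
  move: (Va Logic.I); apply: (@sum_family_min _ _ _ _
    ((fun b : V => mmode b n u) @^-1` sum_family F)) => [|w b wb].
    exact: subspace_preim (mmode_linearl n u) subS.
  move: Su; apply: (@sum_family_min _ _ _ _
    ((fun v : M => mmode b n v) @^-1` sum_family F)) => [|i v Fv].
    exact: subspace_preim (mmode_linearr b n) subS.
  have [j gj] := shg i (w - n - 1).
  apply: (sub_sum_family (i := j) subF).
  by rewrite /F gj; exact: mode_gen_eigenspace.
- apply: (@sum_family_min _ _ _ _ (@degree_op K V M @^-1` sum_family F)).
    exact: subspace_preim degree_op_linear subS.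
  move=> i v Fv; apply: (sub_sum_family (i := i) subF).
  exact: degree_op_gen_eigenspace.
Qed.

End AdmissibleModules.

Theorem lemma3p2 (R : realType) (V : voa R[i]) (M : adm_module V)
    (ssV : zhu_semisimple V) :
  (forall lambda : R[i],
     let F := fun n : int => @gen_eigenspace _ V M (lambda + n%:~R) in
     independent F /\ adm_submodule (sum_family F))
  /\
  (let F := fun lambda : R[i] => @gen_eigenspace _ V M lambda in
   independent F /\ adm_submodule (sum_family F)).
Proof.
split=> [lambda|].
  apply: (@root_sum_adm_submodule _ V M _ (fun n : int => lambda + n%:~R)).
    by move=> m n /addrI/intr_inj.
  by move=> n k; exists (n + k); rewrite rmorphD addrA.
by apply: (@root_sum_adm_submodule _ V M _ id) => // mu k; exists (mu + k%:~R).
Qed.
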